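(* Let $T\ge 1$ be the number of interaction steps, $\alpha_1,\dots,\alpha_T\ge 0$ step coefficients, $\mathcal D$ a distribution over inputs $x$, $\mathcal E$ an environment, and let $\pi_\theta$ (student being optimized), $\pi_{\theta_{\mathrm{old}}}$ (current student) and $\pi_T$ (teacher) be policies. For each $t$ let $q_t^\star(\cdot\mid x,h_t)$ be an ideal target action distribution at each input $x$ and step-$t$ history $h_t$, and let $\ell(\cdot,\cdot)$ be a real-valued loss on pairs of action distributions. Let $d_{\theta_{\mathrm{old}}}^{t}(\cdot\mid x)$ be the step-$t$ history occupancy distribution induced by $\pi_{\theta_{\mathrm{old}}}$ and $\mathcal E$. For each $x$ and $t$ let $\mathcal P_t(\cdot\mid x)$ be a probability distribution on step-$t$ histories, let $w_t(x,\cdot)\ge 0$ be weights with $\mathbb E_{H_t\sim\mathcal P_t(\cdot\mid x)}[w_t(x,H_t)]=1$, and let $\rho_t(h_t\mid x)=w_t(x,h_t)\,\mathcal P_t(h_t\mid x)$. Define $$\mathcal R^\star(\theta;\theta_{\mathrm{old}})=\mathbb E_{x\sim\mathcal D}\Big[\sum_{t=1}^{T}\alpha_t\,\mathbb E_{H_t\sim d_{\theta_{\mathrm{old}}}^{t}(\cdot\mid x)}\big[\ell\big(\pi_\theta(\cdot\mid x,H_t),q_t^\star(\cdot\mid x,H_t)\big)\big]\Big],$$ $$\mathcal L_\rho(\theta;\theta_{\mathrm{old}})=\mathbb E_{x\sim\mathcal D}\Big[\sum_{t=1}^{T}\alpha_t\,\mathbb E_{H_t\sim \rho_t(\cdot\mid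 x)}\big[\ell\big(\pi_\theta(\cdot\mid x,H_t),\pi_T(\cdot\mid x,H_t)\big)\big]\Big],$$ $$\epsilon_{T,t}^{\theta}(x,h_t)=\Big|\ell\big(\pi_\theta(\cdot\mid x,h_t),q_t^\star(\cdot\mid x,h_t)\big)-\ell\big(\pi_\theta(\cdot\mid x,h_t),\pi_T(\cdot\mid x,h_t)\big)\Big|.$$ Assume there is a constant $B<\infty$ such that $\big|\ell\big(\pi_\theta(\cdot\mid x,h_t),q_t^\star(\cdot\mid x,h_t)\big)\big|\le B$ for all $(x,h_t,t)$. Then $$\big|\mathcal R^\star(\theta;\theta_{\mathrm{old}})-\mathcal L_\rho(\theta;\theta_{\mathrm{old}})\big|\le \mathbb E_{x\sim\mathcal D}\Big[\sum_{t=1}^{T}\alpha_t\Big\{2B\,\mathrm{TV}\big(d_{\theta_{\mathrm{old}}}^{t}(\cdot\mid x),\rho_t(\cdot\mid x)\big)+\mathbb E_{H_t\sim\rho_t(\cdot\mid x)}\big[\epsilon_{T,t}^{\theta}(x,H_t)\big]\Big\}\Big].$$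
   Context: A step-$t$ history is a finite sequence $h_t=(o_1,a_1,o_2,a_2,\dots,a_{t-1},o_t)$ of observations $o_s$ and actions $a_s$; observations and actions take values in discrete (countable) sets, so distributions on histories are given by probability mass functions. A policy $\pi$ assigns to each input $x$ and history $h_t$ a probability distribution $\pi(\cdot\mid x,h_t)$ over actions; the environment $\mathcal E$ assigns to each $(x,h_t,a_t)$ a probability distribution $\mathcal E(\cdot\mid x,h_t,a_t)$ over the next observation. For a policy $\pi$, the step-$t$ history occupancy distribution is $d_{\pi,\mathcal E}^{t}(h_t\mid x)=\Pr_{\pi,\mathcal E}(H_t=h_t\mid x)$, the law of the step-$t$ history when actions are drawn from $\pi$ and observations from $\mathcal E$. For $h_{t+1}=(h_t,a_t,o_{t+1})$ it satisfies $$d_{\pi,\mathcal E}^{t+1}(h_{t+1}\mid x)=d_{\pi,\mathcal E}^{t}(h_t\mid x)\,\pi(a_t\mid x,h_t)\,\mathcal E(o_{t+1}\mid x,h_t,a_t).$$ Write $d_{\theta_{\mathrm{old}}}^{t}=d_{\pi_{\theta_{\mathrm{old}}},\mathcal E}^{t}$. By the normalization of the weights, $\rho_t(\cdot\mid x)$ is a probability distribution on step-$t$ histories. $\mathrm{TV}$ is the total-variation distance, $\mathrm{TV}(p,q)=\tfrac12\sum_h|p(h)-q(h)|$. All functions involved are assumed measurable in $x$, and the expectations defining $\mathcal R^\star$ and $\mathcal L_\rho$ are assumed to be well defined and finite. *)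

(* Defs.v *)
From mathcomp Require Import all_boot all_order all_algebra.
From mathcomp Require Import all_classical all_reals all_analysis.

Set Implicit Arguments.
Unset Strict Implicit.
Unset Printing Implicit Defensive.
Import Order.TTheory GRing.Theory Num.Theory.

Local Open Scope classical_set_scope.
Local Open Scope ring_scope.

(* Probability mass functions on a (in practice countable) discrete type. *)
Record dist (R : realType) (K : choiceType) := Dist {
  mass :> K -> R;
  mass_ge0 : forall k, 0 <= mass k;
  mass_sum1 : (\esum_(k in [set: K]) (mass k)%:E = 1)%E }.

Section Discrete.
Variables (R : realType) (K : choiceType).
Implicit Types (p q : K -> R) (f : K -> R).

Definition has_mean p f : Prop :=
  summable [set: K] (fun k => (p k * f k)%:E).

(* E_{k ~ p}[f k], for a mass function p.  [esum] is a supremum of finite sums,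
   only meaningful for nonnegative terms, so positive and negative parts are
   summed separately; when f >= 0 the value may be +oo. *)
Definition mean p f : \bar R :=
  (esum [set: K] (fun k => (p k * f k)%:E)^\+
   - esum [set: K] (fun k => (p k * f k)%:E)^\-)%E.

Definition TV_dist p q : \bar R :=
  ((2^-1)%:E * \esum_(k in [set: K]) `|p k - q k|%:E)%E.

End Discrete.

Lemma ge0_esumZl (R : realType) (K : choiceType) (r : R) (f : K -> R) :
  0 <= r -> (forall k, 0 <= f k) ->
  (\esum_(k in [set: K]) (r * f k)%:E = r%:E * \esum_(k in [set: K]) (f k)%:E)%E.
Proof.
move=> r0 f0; rewrite /esum -ereal_supZl//; last first.
  apply/set0P; exists 0%E => /=; exists set0; last by rewrite fsbig_set0.
  by split => //; exact: finite_set0.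
rewrite image_comp; congr ereal_sup; apply: eq_imagel => F _ /=.
rewrite ge0_mule_fsumr; last by move=> k; rewrite lee_fin.
by apply: eq_fsbigr => k _; rewrite EFinM.
Qed.

Section Joint.
Variables (R : realType) (K L : choiceType).
Variables (p : dist R K) (k : K -> dist R L).

Definition joint_mass (z : K * L) : R := p z.1 * k z.1 z.2.

Lemma joint_mass_ge0 z : 0 <= joint_mass z.
Proof. by rewrite mulr_ge0// mass_ge0. Qed.

Lemma joint_mass_sum1 : (\esum_(z in [set: K * L]) (joint_mass z)%:E = 1)%E.
Proof.
have -> : [set: K * L] = [set: K] `*`` (fun=> [set: L]).
  by apply/seteqP; split => // z _; split.
rewrite -(@esum_esum R K L setT (fun=> setT)
  (fun x y => (p x * k x y)%:E)); last first.
  by move=> x y; rewrite lee_fin mulr_ge0// mass_ge0.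
rewrite -[RHS](mass_sum1 p); apply: eq_esum => x _.
by rewrite ge0_esumZl ?mass_ge0//; [rewrite mass_sum1 mule1|exact: mass_ge0].
Qed.

(* Law of (x, y) when x ~ p and then y ~ k x. *)
Definition joint : dist R (K * L)%type := Dist joint_mass_ge0 joint_mass_sum1.

End Joint.

(* [hist O A n] is the type of step-(n+1) histories: an element of [hist O A n]
   is a left-nested tuple (o_1, a_1, o_2, ..., a_n, o_(n+1)). Accordingly an
   index t : 'I_T stands for the interaction step t + 1 of {1, ..., T}. *)
Fixpoint hist (O A : countType) (n : nat) : countType :=
  if n is m.+1 then (hist O A m * A * O)%type else O.

Section Interaction.
Variables (R : realType) (X : Type) (O A : countType).

Definition policy := X -> forall n : nat, hist O A n -> dist R A.

(* [env_init] is the law of the first observation o_1, i.e. of the step-1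
   history; [env_step] gives the law of the next observation. *)
Record environment := Environment {
  env_init : X -> dist R O;
  env_step : X -> forall n : nat, hist O A n -> A -> dist R O }.

(* Law of the step-(n+1) history under policy pi and environment E:
   d^1 = env_init and d^(t+1)(h, a, o) = d^t(h) pi(a | h) E(o | h, a). *)
Fixpoint occupancy (E : environment) (pi : policy) (x : X) (n : nat) :
    dist R (hist O A n) :=
  if n is m.+1 then
    joint (joint (occupancy E pi x m) (pi x m))
          (fun ha => env_step E x ha.1 ha.2)
  else env_init E x.

Section Steps.
Variable T : nat.

Definition step_masses := forall t : 'I_T, X -> hist O A t -> R.
Definition step_targets := forall t : 'I_T, X -> hist O A t -> dist R A.

Definition occupancy_masses (E : environment) (pi : policy) : step_masses :=
  fun t x => occupancy E pi x t.

Definition policy_targets (pi : policy) : step_targets :=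
  fun t x h => pi x t h.

Definition reweight (P : forall t : 'I_T, X -> dist R (hist O A t))
    (w : forall t : 'I_T, X -> hist O A t -> R) : step_masses :=
  fun t x h => w t x h * P t x h.

Definition step_loss (ell : dist R A -> dist R A -> R) (pi : policy)
    (target : step_targets) (t : 'I_T) (x : X) (h : hist O A t) : R :=
  ell (pi x t h) (target t x h).

Definition teacher_gap (ell : dist R A -> dist R A -> R)
    (pi pi_T : policy) (q : step_targets) (t : 'I_T) (x : X)
    (h : hist O A t) : R :=
  `| ell (pi x t h) (q t x h) - ell (pi x t h) (pi_T x t h) |.

End Steps.
End Interaction.

Arguments step_loss {R X O A T} ell pi target t x h.
Arguments teacher_gap {R X O A T} ell pi pi_T q t x h.
Arguments occupancy_masses {R X O A T} E pi t x h.
Arguments policy_targets {R X O A T} pi t x h.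
Arguments reweight {R X O A T} P w t x h.

Section Risk.
Variables (R : realType) (disp : measure_display) (X : measurableType disp).
Variables (O A : countType) (T : nat).

Definition risk (D : probability X R) (alpha : 'I_T -> R)
    (mu : step_masses R X O A T) (ell : dist R A -> dist R A -> R)
    (pi : policy R X O A) (target : step_targets R X O A T) : \bar R :=
  (\int[D]_x \sum_(t < T)
     (alpha t)%:E * mean (mu t x) (step_loss ell pi target t x))%E.

Definition risk_well_defined (D : probability X R) (alpha : 'I_T -> R)
    (mu : step_masses R X O A T) (ell : dist R A -> dist R A -> R)
    (pi : policy R X O A) (target : step_targets R X O A T) : Prop :=
  (forall t : 'I_T,
     {ae D, forall x, has_mean (mu t x) (step_loss ell pi target t x)}) /\
  D.-integrable [set: X]
    (fun x => \sum_(t < T)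
       (alpha t)%:E * mean (mu t x) (step_loss ell pi target t x))%E.

End Risk.

Section Measurability.
Variables (R : realType) (disp : measure_display) (X : measurableType disp).
Variables (O A : countType).

Definition measurable_mass (K : choiceType) (p : X -> K -> R) : Prop :=
  forall k, measurable_fun [set: X] (fun x => p x k).

Definition measurable_policy (pi : policy R X O A) : Prop :=
  forall n (h : hist O A n), measurable_mass (fun x => pi x n h).

Definition measurable_environment (E : environment R X O A) : Prop :=
  measurable_mass (env_init E) /\
  forall n (h : hist O A n) a, measurable_mass (fun x => env_step E x h a).

End Measurability.

(* Main.v *)
(* At a fixed input and step, write d for the occupancy mass, f and g for the
   losses against the ideal target and the teacher.  The identity
   d f - rho g = (d - rho) f + rho (f - g) and |f| <= B give
   |E_d f - E_rho g| <= B sum |d - rho| + E_rho |f - g|, and the first term is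
   2 B TV(d, rho).  This holds at every input, also where g is not
   rho-summable: there E_rho |f - g| = +oo because f is bounded.  Summing over
   the steps and integrating over the inputs gives the claim. *)
Require Import Defs.
From mathcomp Require Import all_boot all_order all_algebra.
From mathcomp Require Import all_classical all_reals all_analysis.
From mathcomp Require Import ring lra.

Set Implicit Arguments.
Unset Strict Implicit.
Unset Printing Implicit Defensive.
Import Order.TTheory GRing.Theory Num.Theory.

Local Open Scope classical_set_scope.
Local Open Scope ring_scope.

Section Discrete.
Variables (R : realType) (K : choiceType).
Implicit Types (p r f g u v : K -> R).
Local Open Scope ereal_scope.

(** [mean p f] is, by conversion, [signed_esum] of the products [p k * f k]. Keeping only the
    product lets means under different mass functions be subtracted termwise. *)
Definition signed_esum u : \bar R :=
  esum [set: K] (EFin \o u)^\+ - esum [set: K] (EFin \o u)^\-.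

Lemma ge0_esum_fin_num (z : K -> \bar R) :
  (forall k, 0 <= z k) -> summable [set: K] z ->
  esum [set: K] z \is a fin_num.
Proof.
move=> z0; rewrite summableE; congr (_ \is a fin_num).
by apply: eq_esum => k _; rewrite gee0_abs.
Qed.

Lemma signed_esumB u v :
  summable [set: K] (EFin \o u) -> summable [set: K] (EFin \o v) ->
  signed_esum (u \- v)%R = signed_esum u - signed_esum v.
Proof.
move=> su sv; rewrite /signed_esum.
have [sup sun] := (summable_funepos su, summable_funeneg su).
have [svp svn] := (summable_funepos sv, summable_funeneg sv).
(* [esumB] applies to a difference of two nonnegative summable functions, so the four parts are
   regrouped by sign. All four sums are finite, and the rest is arithmetic in [R]. *)
have -> : EFin \o (u \- v)%R =
    ((EFin \o u)^\+ \+ (EFin \o v)^\-) \- ((EFin \o u)^\- \+ (EFin \o v)^\+).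
  apply/funext => k; rewrite /= !funeposE !funenegE /=.
  rewrite -!EFin_max -!EFinD; congr EFin.
  by rewrite /Num.max /Order.max; do ?case: ifPn => ?; lra.
rewrite esumB ?esumD//; first last.
- by move=> k _; rewrite adde_ge0.
- by move=> k _; rewrite adde_ge0.
- exact: summableD.
- exact: summableD.
have fup := ge0_esum_fin_num (funepos_ge0 _) sup.
have fum := ge0_esum_fin_num (funeneg_ge0 _) sun.
have fvp := ge0_esum_fin_num (funepos_ge0 _) svp.
have fvm := ge0_esum_fin_num (funeneg_ge0 _) svn.
rewrite -(fineK fup) -(fineK fum) -(fineK fvp) -(fineK fvm).
by rewrite -!(EFinD, EFinN); congr EFin; ring.
Qed.

(** Triangle inequality on the two parts, whose sum is [|u|]. Divergent sums are covered too, so for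
    a summable [u] it also yields finiteness of [signed_esum u]. *)
Lemma abse_signed_esum_le u :
  `|signed_esum u| <= \esum_(k in [set: K]) `|(u k)%:E|.
Proof.
rewrite /signed_esum (le_trans (lee_abs_sub _ _))// !gee0_abs ?esum_ge0//.
rewrite -esumD//; apply: le_esum => k _.
by have /(congr1 (@^~ k))/= <- := fune_abse (EFin \o u).
Qed.

Lemma ge0_mean p f : (forall k, 0 <= p k)%R -> (forall k, 0 <= f k)%R ->
  mean p f = \esum_(k in [set: K]) (p k * f k)%:E.
Proof.
move=> p0 f0; rewrite /mean [X in _ - X]esum1 ?sube0; last first.
  move=> k _; rewrite (ge0_funenegE (D := setT)) ?inE// => ? _.
  by rewrite lee_fin mulr_ge0.
apply: eq_esum => k _; rewrite (ge0_funeposE (D := setT)) ?inE// => ? _.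
by rewrite lee_fin mulr_ge0.
Qed.

Lemma summable_mul_bounded p f (B : R) :
  (0 <= B)%R -> (forall k, `|f k| <= B)%R -> summable [set: K] (EFin \o p) ->
  summable [set: K] (fun k => (p k * f k)%:E).
Proof.
move=> B0 fB; rewrite /summable => sp.
apply: (@le_lt_trans _ _ (B%:E * \esum_(k in [set: K]) `|p k|%:E)).
  rewrite -ge0_esumZl//; apply: le_esum => k' _.
  by rewrite /= lee_fin normrM mulrC ler_wpM2r.
by rewrite lte_mul_pinfty// lee_fin.
Qed.

Lemma abse_meanB_le p r f g (B : R) : (0 <= B)%R ->
  (forall k, 0 <= r k)%R -> (forall k, `|f k| <= B)%R ->
  summable [set: K] (EFin \o p) -> summable [set: K] (EFin \o r) ->
  `|mean p f - mean r g| <=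
    (2 * B)%:E * TV_dist p r + mean r (fun k => `|f k - g k|%R).
Proof.
move=> B0 r0 fB sp sr.
have -> : (2 * B)%:E * TV_dist p r = \esum_(k in [set: K]) (B * `|p k - r k|)%:E.
  rewrite ge0_esumZl// /TV_dist muleA -EFinM; by congr (_%:E * _); field.
rewrite (ge0_mean (f := fun k => `|f k - g k|%R) r0)//.
(* If the mean gap is [+oo], so is the right-hand side. Otherwise [r * (f - g)] is summable, and
   subtracting it from [r * f] shows that [r * g] is summable as well. *)
have [rfg_oo|rfg_fin] := eqVneq (\esum_(k in [set: K]) (r k * `|f k - g k|)%:E) +oo.
  rewrite rfg_oo addey ?leey// gt_eqF// (lt_le_trans ltNy0)// esum_ge0//.
  by move=> k _; rewrite lee_fin mulr_ge0.
have spf := summable_mul_bounded B0 fB sp.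
have srf := summable_mul_bounded B0 fB sr.
have srg : summable [set: K] (fun k => (r k * g k)%:E).
  have -> : (fun k => (r k * g k)%:E) =
      (fun k => (r k * f k)%:E) \- (fun k => (r k * (f k - g k))%:E).
    by apply/funext => k /=; rewrite -EFinB; congr EFin; ring.
  apply: summableB => //; rewrite /summable ltey.
  apply: contra rfg_fin => /eqP <-; apply/eqP/eq_esum => k _ /=.
  by rewrite normrM ger0_norm.
rewrite -/(signed_esum (fun k => p k * f k)%R) -/(signed_esum (fun k => r k * g k)%R).
rewrite -signed_esumB// (le_trans (abse_signed_esum_le _))// -esumD; first last.
- by move=> k _; rewrite lee_fin mulr_ge0.
- by move=> k _; rewrite lee_fin mulr_ge0.
apply: le_esum => k _; rewrite /= -EFinD lee_fin.
have -> : (p k * f k - r k * g k = (p k - r k) * f k + r k * (f k - g k))%R by ring.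
rewrite (le_trans (ler_normD _ _))// !normrM (ger0_norm (r0 k)) lerD2r mulrC.
by rewrite ler_wpM2r.
Qed.

(** Over an empty type the total mass would be 0, not 1. This supplies a history at which the loss
    bound can be evaluated to get [0 <= B]. *)
Lemma dist_inhabited (p : dist R K) : inhabited K.
Proof.
apply: contrapT => noK; have := mass_sum1 p; rewrite esum1.
  by move=> /eqP; rewrite eq_sym onee_eq0.
by move=> k; case: noK; exists.
Qed.

End Discrete.

Section SumGaps.
Variable R : realType.
Local Open Scope ereal_scope.

(** Since each [a] is finite, an infinite [b] forces the matching [c] to be [+oo]. What remains is
    the triangle inequality in [R]. *)
Lemma lee_abs_sub_add (a1 b1 c1 a2 b2 c2 : \bar R) :
  a1 \is a fin_num -> a2 \is a fin_num ->
  `|a1 - b1| <= c1 -> `|a2 - b2| <= c2 ->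
  `|(a1 + a2) - (b1 + b2)| <= c1 + c2.
Proof.
move: a1 a2 b1 b2 c1 c2 => [a1| |] [a2| |] [b1| |] [b2| |] [c1| |] [c2| |] //= _ _; last 3 first.
- by move=> *; rewrite leey.
- by move=> *; rewrite leey.
- by move=> *; rewrite leey.
rewrite !lee_fin => h1 h2; rewrite opprD addrACA.
by rewrite (le_trans (ler_normD _ _))// lerD.
Qed.

Lemma lee_abs_sub_sum (n : nat) (alpha : 'I_n -> R) (a b c : 'I_n -> \bar R) :
  (forall t, 0 <= alpha t)%R -> (forall t, a t \is a fin_num) ->
  (forall t, `|a t - b t| <= c t) ->
  `|\sum_(t < n) (alpha t)%:E * a t - \sum_(t < n) (alpha t)%:E * b t| <=
  \sum_(t < n) (alpha t)%:E * c t.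
Proof.
move=> alpha0 afin abc.
(* The induction carries finiteness of the partial sum of the [a] terms along with the bound, as
   [lee_abs_sub_add] asks for it at each step. *)
pose Q x y z := (x \is a fin_num) && (`|x - y| <= z :> \bar R).
suff /andP[] : Q (\sum_(t < n) (alpha t)%:E * a t)
  (\sum_(t < n) (alpha t)%:E * b t) (\sum_(t < n) (alpha t)%:E * c t) by [].
apply: (big_rec3 Q) => [|t z y x _ /andP[xfin xyz]].
  by rewrite /Q sube0 abse0 lexx.
rewrite /Q fin_numD fin_numM//= xfin/= lee_abs_sub_add// ?fin_numM//.
rewrite -muleBr ?fin_num_adde_defr//.
by rewrite abseM gee0_abs ?lee_fin// lee_wpmul2l ?lee_fin.
Qed.

End SumGaps.

Import HBNNSimple.

(* The integral of a nonnegative function is a supremum over the simple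
   functions below it, so it is monotone even on non-measurable functions. *)
Lemma ge0_le_integralT d (X : measurableType d) (R : realType)
    (mu : {measure set X -> \bar R}) (f g : X -> \bar R) :
  (forall x, 0 <= f x)%E -> (forall x, f x <= g x)%E ->
  (\int[mu]_x f x <= \int[mu]_x g x)%E.
Proof.
move=> f0 fg; rewrite !ge0_integralTE//; last by move=> x; exact: le_trans (fg x).
apply: ereal_sup_le => _ [h hf <-]; exists h => // x.
exact: le_trans (hf x) (fg x).
Qed.

Theorem proposition1 (R : realType)
  (disp : measure_display) (X : measurableType disp) (D : probability X R)
  (O A : countType) (T : nat) (hT : (1 <= T)%N)
  (alpha : 'I_T -> R) (halpha : forall t : 'I_T, 0 <= alpha t)
  (E : environment R X O A)
  (pi_theta pi_old pi_T : policy R X O A)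
  (q : step_targets R X O A T)
  (ell : dist R A -> dist R A -> R)
  (P : forall t : 'I_T, X -> dist R (hist O A t))
  (w : forall t : 'I_T, X -> hist O A t -> R)
  (hw0 : forall (t : 'I_T) (x : X) (h : hist O A t), 0 <= w t x h)
  (hw1 : forall (t : 'I_T) (x : X), mean (P t x) (w t x) = 1%E)
  (hE : measurable_environment E)
  (hpi_theta : measurable_policy pi_theta)
  (hpi_old : measurable_policy pi_old)
  (hpi_T : measurable_policy pi_T)
  (hq : forall (t : 'I_T) (h : hist O A t),
     measurable_mass (fun x : X => q t x h))
  (hP : forall t : 'I_T, measurable_mass (P t))
  (hw : forall t : 'I_T, measurable_mass (w t))
  (hell_q : forall (t : 'I_T) (h : hist O A t),
     measurable_fun [set: X] (fun x : X => ell (pi_theta x t h) (q t x h)))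
  (hell_T : forall (t : 'I_T) (h : hist O A t),
     measurable_fun [set: X] (fun x : X => ell (pi_theta x t h) (pi_T x t h)))
  (hRstar : risk_well_defined D alpha (occupancy_masses E pi_old)
     ell pi_theta q)
  (hLrho : risk_well_defined D alpha (reweight P w)
     ell pi_theta (policy_targets pi_T))
  (B : R)
  (hB : forall (t : 'I_T) (x : X) (h : hist O A t),
     `| ell (pi_theta x t h) (q t x h) | <= B) :
  (`| risk D alpha (occupancy_masses E pi_old) ell pi_theta q
      - risk D alpha (reweight P w) ell pi_theta (policy_targets pi_T) | <=
   \int[D]_x \sum_(t < T) (alpha t)%:E *
     ((2 * B)%:E * TV_dist (occupancy_masses E pi_old t x) (reweight P w t x)
      + mean (reweight P w t x) (teacher_gap ell pi_theta pi_T q t x)))%E.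
Proof.
set F := fun x => (\sum_(t < T) (alpha t)%:E *
  mean (occupancy_masses E pi_old t x) (step_loss ell pi_theta q t x))%E.
set G := fun x => (\sum_(t < T) (alpha t)%:E *
  mean (reweight P w t x) (step_loss ell pi_theta (policy_targets pi_T) t x))%E.
have [_ iF] := hRstar; have [_ iG] := hLrho.
rewrite /risk -/F -/G -integralB//.
apply: le_trans (le_abse_integral _ _ _) _ => //.
  exact: measurable_int (integrableB _ iF iG).
(* The integrands are compared at every input, by monotonicity alone, so measurability of the
   bounding integrand does not have to be established. *)
apply: ge0_le_integralT => // x /=.
have sum_dist (K : choiceType) (p : dist R K) : summable [set: K] (EFin \o p).
  rewrite /summable (eq_esum (b := fun k => (p k)%:E)) ?mass_sum1 ?ltry// => k _.
  by rewrite /= ger0_norm// mass_ge0.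
have B0 (t : 'I_T) : 0 <= B.
  have [h] := dist_inhabited (P t x).
  exact: le_trans (hB t x h).
apply: lee_abs_sub_sum => // t.
  (* The ideal-target mean is finite at every [x]: the loss is bounded by [B] and the occupancy has
     mass 1. *)
  rewrite fin_num_abs (le_lt_trans (abse_signed_esum_le _))//.
  exact: summable_mul_bounded (B0 t) (hB t x) (sum_dist _ _).
have P0 h : 0 <= P t x h by exact: mass_ge0.
apply: abse_meanB_le; first exact: B0 t.
- by move=> h; rewrite mulr_ge0.
- exact: hB.
- exact: sum_dist.
(* Up to the order of the factors, the total mass of [reweight P w] is the mean of [w] under [P],
   which is 1 by [hw1]. *)
rewrite /summable (eq_esum (b := fun h => (P t x h * w t x h)%:E)).
  by rewrite -ge0_mean// hw1 ltry.
by move=> h _; rewrite /= /reweight mulrC ger0_norm// mulr_ge0.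
Qed.
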